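(* Let $X$ be a stacked simplicial complex of dimension $d$ with vertex set $V$ and facet set $F$, and let $r\ge1$ and $s\ge1$ be integers. Then the maps $\Phi$ and $\Psi$ restrict to mutually inverse bijections between the set of partitions of $V$ into $r+d$ non-empty parts, each part being $(s+1)$-scattered, and the set of partitions of $F$ into $r$ non-empty parts, each part being $s$-scattered.
   Context: A simplicial complex $X$ on a finite vertex set $V$ is a family of subsets (faces) of $V$ closed under taking subsets, every element of $V$ lying in some face; facets are inclusion-maximal faces. $X$ is pure of dimension $d$ if every facet has $d+1$ elements; a codimension one face is a face with $d$ elements. $X$ is stacked if it is pure of some dimension $d$ and its facets can be ordered $F_0,\dots,F_k$ such that for each $p\ge1$, $F_p$ contains exactly one vertex $v_p$ not in $F_0\cup\dots\cup F_{p-1}$, and $F_p\setminus\{v_p\}\subseteq F_j$ for some $j<p$. A walk is a sequence of facets $f_1,\dots,f_p$ ($p\ge1$) with each $f_i\cap f_{i+1}$ of exactly $d$ elements; a path is a walk in which the faces $f_i\cap f_{i+1}$, $1\le i<p$, are pairwise distinct; in a stacked complex there is a unique path between any two facets. For faces $h,k$ with $h\cup k$ not contained in any codimension one face, a path between $h$ and $k$, written $h\,|\,f_1,\dots,f_p\,|\,k$, is a path with $h\subseteq f_1$, $k\subseteq f_p$ and, if $p\ge2$, $h\not\subseteq f_1\cap f_2$, $k\not\subseteq f_p\cap f_{p-1}$; in a stacked complex it exists and is unique. Distances: for facets $f,g$, $\mathrm{dist}(f,g)$ is the minimal $p-1$ over walks $f_1,\dots,f_p$ with $f_1=f$, $f_p=g$;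 for distinct vertices $v,w$, $\mathrm{dist}(v,w)$ is the minimal $p\ge1$ such that there is a walk $f_1,\dots,f_p$ with $v\in f_1$, $w\in f_p$. A set of vertices (resp. facets) is $s$-scattered if any two distinct elements have distance $\ge s$; an independent set of vertices is a $2$-scattered one. The map $\Phi$ (vertex partitions into independent sets $\to$ facet partitions): given such a partition $\mathcal V$ of $V$, for distinct facets $f,f'$ with unique path $f=f_1,\dots,f_p=f'$, let $v$ be the element of $f_1\setminus f_2$ and $w$ the element of $f_p\setminus f_{p-1}$; set $f\sim'_F f'$ iff $v,w$ lie in the same part $P$ of $\mathcal V$ and none of $f_2,\dots,f_{p-1}$ contains a vertex of $P$; $\Phi(\mathcal V)$ is the partition of $F$ into classes of the equivalence relation generated by $\sim'_F$. The map $\Psi$ (facet partitions $\to$ vertex partitions): given a partition $\mathcal F$ of $F$, for distinct vertices $v,w$ not lying in a common facet, with unique path $v\,|\,f_1,\dots,f_p\,|\,w$, set $v\sim'_V w$ iff $f_1,f_p$ lie in the same part $Q$ of $\mathcal F$ and none of $f_2,\dots,f_{p-1}$ lies in $Q$; $\Psi(\mathcal F)$ is the partition of $V$ into classes of the equivalence relation generated by $\sim'_V$. *)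

(* Defs.v *)
From HB Require Import structures.
From mathcomp Require Import all_boot.
From mathcomp Require Import boolp.
From Stdlib Require Import Relations.

Set Implicit Arguments.
Unset Strict Implicit.
Unset Printing Implicit Defensive.

Section Complex.
Variable T : finType.
Implicit Types (X : {set {set T}}) (f g : {set T}) (s : seq {set T}).

Definition is_simplicial_complex X :=
  (forall f g, f \in X -> g \subset f -> g \in X) /\
  (forall v : T, exists2 f, f \in X & v \in f).

Definition is_facet X f :=
  (f \in X) && [forall g, ((g \in X) && (f \subset g)) ==> (g == f)].

Definition facets X := [set f | is_facet X f].

Definition pure X (d : nat) := forall f, is_facet X f -> #|f| = d.+1.

Definition stacked X :=
  exists d, pure X d /\
  exists s, [/\ 0 < size s, uniq s, (forall f, is_facet X f <-> f \in s) &
    forall p, 0 < p < size s ->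
      exists v, [set x in nth set0 s p |
                   x \notin \bigcup_(j < p) nth set0 s j] = [set v] /\
      exists2 j, j < p & nth set0 s p :\ v \subset nth set0 s j].

Definition adj (d : nat) f g := #|f :&: g| == d.

Definition walk X (d : nat) s :=
  if s is x :: s' then all (is_facet X) s && path (adj d) x s' else false.

Definition ridges s :=
  if s is x :: s' then pairmap (fun a b => a :&: b) x s' else [::].

Definition fpath X d s := walk X d s && uniq (ridges s).

Definition inner s := take (size s).-2 (behead s).

Definition facets_scattered X d (sc : nat) (Q : {set {set T}}) :=
  forall f g, f \in Q -> g \in Q -> f != g ->
  forall s, walk X d s -> head set0 s = f -> last set0 s = g ->
  sc <= (size s).-1.

Definition vertices_scattered X d (sc : nat) (P : {set T}) :=
  forall v w, v \in P -> w \in P -> v != w ->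
  forall s, walk X d s -> v \in head set0 s -> w \in last set0 s ->
  sc <= size s.

Definition phi_rel X d (VP : {set {set T}}) f f' : Prop :=
  [/\ is_facet X f, is_facet X f', f != f' &
   exists s, [/\ fpath X d s, head set0 s = f, last set0 s = f' &
     exists2 P, P \in VP & exists v w, [/\ v \in P, w \in P,
        f :\: nth set0 s 1 = [set v],
        f' :\: nth set0 s (size s).-2 = [set w] &
        all (fun g => [disjoint g & P]) (inner s)]]].

Definition Phi X d (VP : {set {set T}}) : {set {set {set T}}} :=
  [set [set g in facets X | `[< clos_refl_sym_trans _ (phi_rel X d VP) f g >]]
     | f in facets X].

Definition psi_rel X d (FQ : {set {set {set T}}}) (v w : T) : Prop :=
  [/\ v != w, ~~ [exists f, [&& is_facet X f, v \in f & w \in f]] &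
   exists s, [/\ fpath X d s, v \in head set0 s, w \in last set0 s,
      (1 < size s -> v \notin head set0 s :&: nth set0 s 1 /\
                     w \notin last set0 s :&: nth set0 s (size s).-2) &
      exists2 Q, Q \in FQ & [/\ head set0 s \in Q, last set0 s \in Q &
                                all (fun g => g \notin Q) (inner s)]]].

Definition Psi X d (FQ : {set {set {set T}}}) : {set {set T}} :=
  [set [set w | `[< clos_refl_sym_trans _ (psi_rel X d FQ) v w >]] | v : T].

Definition vertex_partition_ok X d (n sc : nat) (VP : {set {set T}}) :=
  [/\ partition VP [set: T], #|VP| = n &
      forall P, P \in VP -> vertices_scattered X d sc P].

Definition facet_partition_ok X d (n sc : nat) (FQ : {set {set {set T}}}) :=
  [/\ partition FQ (facets X), #|FQ| = n &
      forall Q, Q \in FQ -> facets_scattered X d sc Q].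

End Complex.

(* Main.v *)
(**
Color the vertices and the facets by the parts of the two partitions; there are
[d] more vertex colors than facet colors. Looking from a facet [f], whose [d + 1]
vertices have distinct colors, each of the other vertex colors corresponds to one
of the other facet colors. Crossing the ridge [f :&: g] changes this
correspondence only by exchanging the roles of the vertices of [f :\: g] and
[g :\: f]. So, following a walk that leaves a vertex [v] of [f], the next facet
in the part of [f] is the next facet having a vertex of the color of [v]: both
maps, and both scattering conditions, can be read off from this. Since
the correspondences agree across a ridge outside the colors of its vertices, a
coloring of the vertices determines one of the facets and conversely, by adding
the facets in the stacking order: the new vertex [v] and the new facet [f],
glued to [g] along [f :\ v], must have corresponding colors seen from [g].
*)

Require Import Defs.
From HB Require Import structures.
From mathcomp Require Import all_boot.
From mathcomp Require Import boolp.
From Stdlib Require Import Relations.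

Set Implicit Arguments.
Unset Strict Implicit.
Unset Printing Implicit Defensive.

(** * Injections, colorings and partitions into color classes *)

Lemma exists_inj_into (U W : finType) (w0 : W) (S : {set U}) (S' : {set W}) :
  #|S| <= #|S'| ->
  exists h : U -> W, {in S &, injective h} /\ {in S, forall x, h x \in S'}.
Proof.
move=> leS; have idx x : x \in S -> index x (enum S) < size (enum S').
  by move=> xS; rewrite -cardE (leq_trans _ leS) // cardE index_mem mem_enum.
exists (fun x => nth w0 (enum S') (index x (enum S))); split=> [x y xS yS | x xS].
  move/eqP; rewrite nth_uniq ?idx ?enum_uniq // => /eqP.
  by apply: (@index_inj _ x (enum S)); rewrite mem_enum.
by rewrite -mem_enum mem_nth ?idx.
Qed.

Lemma card_preim_partition (U W : finType) (h : U -> W) (D : {set U}) :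
  #|preim_partition h D| = #|h @: D|.
Proof.
pose fib w := [set x in D | w == h x].
have -> : preim_partition h D = fib @: (h @: D).
  by rewrite -imset_comp; apply: eq_imset.
apply: card_in_imset => _ _ /imsetP[x xD ->] /imsetP[y yD ->] /setP/(_ x).
by rewrite !inE xD eqxx => /esym/eqP.
Qed.

Lemma mem_preim_partition (U W : finType) (h : U -> W) (D : {set U}) x :
  x \in D -> [set y in D | h x == h y] \in preim_partition h D.
Proof. by move=> xD; apply/imsetP; exists x. Qed.

Lemma preim_partition_block (U W : finType) (h : U -> W) (D P : {set U}) x :
  P \in preim_partition h D -> x \in P -> P = [set y in D | h x == h y].
Proof.
case/imsetP=> z zD -> /[!inE] /andP[xD /eqP hzx].
by apply/setP=> y; rewrite !inE hzx.
Qed.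

(** The color of a point is the rank of its block in [enum P]. Every color is used because there are
    as many blocks as colors. *)
Lemma partition_coloring (U : finType) (D : {set U}) (P : {set {set U}}) n :
  partition P D -> #|P| = n.+1 ->
  exists2 h : U -> 'I_n.+1, preim_partition h D = P & h @: D = setT.
Proof.
move=> partP cardP.
have [tiP covP] : trivIset P /\ cover P = D.
  by case/and3P: partP => /eqP -> ->.
pose h x : 'I_n.+1 := inord (index (pblock P x) (enum P)).
have blk x : x \in D -> pblock P x \in P by move=> xD; rewrite pblock_mem ?covP.
have idx x : x \in D -> index (pblock P x) (enum P) < n.+1.
  by move=> xD; rewrite -cardP cardE index_mem mem_enum blk.
have hE x y : x \in D -> y \in D -> (h x == h y) = (pblock P x == pblock P y).
  move=> xD yD; apply/eqP/eqP => [/(congr1 val)|]; last by rewrite /h => ->.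
  rewrite /= !inordK ?idx // => e.
  by apply: (@index_inj _ (pblock P x) (enum P)) e; rewrite mem_enum blk.
have hP : preim_partition h D = P.
  rewrite -[RHS](preim_partition_pblock partP); apply: eq_in_imset => x xD.
  by apply/setP=> y; rewrite !inE; case yD: (y \in D); rewrite //= hE.
exists h => //; apply/eqP; rewrite eqEcard subsetT /= cardsT card_ord.
by rewrite -card_preim_partition hP cardP.
Qed.

(** * Adjacent facets and the ridges of a walk *)

Section Adjacency.
Variables (T : finType) (d : nat).
Implicit Types f g R : {set T}.

Lemma adj_sym f g : adj d f g = adj d g f.
Proof. by rewrite /adj setIC. Qed.

(** Distinct facets share at most [d] vertices, so a common set of [d] vertices is their whole
    intersection. *)
Lemma setI_ridge f g R : #|f| = d.+1 -> #|g| = d.+1 -> f != g ->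
  #|R| = d -> R \subset f -> R \subset g -> f :&: g = R.
Proof.
move=> cf cg fg cR Rf Rg; apply/esym/eqP; rewrite eqEcard subsetI Rf Rg cR /=.
rewrite -ltnS -cf ltn_neqAle subset_leq_card ?subsetIl // andbT.
apply: contra fg => /eqP ce.
have fI : f :&: g = f by apply/eqP; rewrite eqEcard subsetIl ce leqnn.
by rewrite eqEcard cf cg leqnn andbT; apply/setIidPl.
Qed.

Lemma adj_diff f g : #|f| = d.+1 -> adj d f g -> exists v, f :\: g = [set v].
Proof.
by move=> cf /eqP cI; apply/cards1P; rewrite cardsD cf cI subSn // subnn.
Qed.

Lemma adj_diffE f g w : #|f| = d.+1 -> adj d f g -> w \in f -> w \notin g ->
  f :\: g = [set w].
Proof.
move=> cf afg wf wg; have [v e] := adj_diff cf afg; rewrite e.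
by have /set1P-> : w \in [set v] by rewrite -e inE wf wg.
Qed.

Lemma ridges_cat (x : {set T}) s1 s2 :
  ridges (x :: s1 ++ s2) = ridges (x :: s1) ++ ridges (last x s1 :: s2).
Proof. by rewrite /= pairmap_cat. Qed.

Lemma uniq_ridges_cat (x : {set T}) s1 g s2 : uniq (ridges (x :: s1 ++ g :: s2)) ->
  uniq (ridges (x :: rcons s1 g)) /\ uniq (ridges (g :: s2)).
Proof.
by rewrite -cat_rcons ridges_cat last_rcons cat_uniq => /and3P[].
Qed.

End Adjacency.

(* The color [a] seen from the facet [f]: [y f a] is the class of [f] when [f]
   has a vertex of color [a]; otherwise it is the class of the facets at which
   a walk leaving [f] first meets the color [a]. *)
Record coupled (T A B : finType) (d : nat) (F : {set {set T}})
    (c : T -> A) (q : {set T} -> B) (y : {set T} -> A -> B) : Prop := Coupled {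
  coupled_inj : forall f, f \in F -> {in f &, injective c};
  coupled_on : forall f u, f \in F -> u \in f -> y f (c u) = q f;
  coupled_off : forall f a a', f \in F -> y f a = y f a' ->
    a = a' \/ a \in c @: f /\ a' \in c @: f;
  coupled_adj : forall f g a, f \in F -> g \in F -> adj d f g ->
    a \notin c @: (f :&: g) -> y f a = y g a
}.

(** * Consequences of a coupling *)

Section Coupled.
Variables (T A B : finType) (d : nat) (F : {set {set T}}).
Variables (c : T -> A) (q : {set T} -> B) (y : {set T} -> A -> B).
Implicit Types (f g R : {set T}) (a : A) (b : B).
Hypothesis cardF : forall f, f \in F -> #|f| = d.+1.
Hypothesis cpl : coupled d F c q y.

Let c_inj f : f \in F -> {in f &, injective c} := coupled_inj cpl (f := f).

(** For a vertex [u] of [f], [q f] is [y f (c u)], and [coupled_off] lets another color share this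
    class only if it also occurs in [f]. *)
Lemma coupledE f a : f \in F -> (y f a == q f) = (a \in c @: f).
Proof.
move=> fF; apply/eqP/idP => [yq|/imsetP[u uf ->]]; last exact: (coupled_on cpl).
have /card_gt0P[u uf] : 0 < #|f| by rewrite cardF.
have [->|[]//] := coupled_off cpl fF (etrans yq (esym (coupled_on cpl fF uf))).
exact: imset_f.
Qed.

Lemma coupled_step f g v : f \in F -> g \in F -> adj d f g -> v \in f -> v \notin g ->
  y g (c v) = q f.
Proof.
move=> fF gF afg vf vg; rewrite -(coupled_on cpl fF vf).
apply/esym/(coupled_adj cpl) => //; apply/imsetP=> -[u /setIP[uf ug]].
by move/(c_inj fF vf uf)=> e; rewrite e ug in vg.
Qed.

(** The only color of [f] outside those of [R] is that of the vertex opposite to [R], so the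
    exceptional case of [coupled_off] cannot produce a collision. *)
Lemma coupled_ridge_inj f R : f \in F -> R \subset f -> #|R| = d ->
  {in ~: (c @: R) &, injective (y f)}.
Proof.
move=> fF Rf cR a a' /[!inE] aR a'R /(coupled_off cpl fF)[//|[]].
case/imsetP=> u uf au /imsetP[u' uf' au']; rewrite au au'; congr c.
have : #|f :\: R| = 1 by rewrite cardsD (setIidPr Rf) cR cardF // subSn // subnn.
move/eqP/cards1P=> [z fR].
have zE w : w \in f -> c w \notin c @: R -> w = z.
  move=> wf wR; apply/set1P; rewrite -fR inE wf andbT.
  by apply: contra wR => wR; apply: imset_f.
by rewrite au in aR; rewrite au' in a'R; rewrite (zE u uf aR) (zE u' uf' a'R).
Qed.

(** At most [d] colors occur on [R], so at least [#|B|] remain, and an injection from these into [B]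
    is onto. *)
Lemma coupled_ridge_onto f R b : #|A| = #|B| + d ->
  f \in F -> R \subset f -> #|R| = d -> exists2 a, a \notin c @: R & y f a = b.
Proof.
move=> cA fF Rf cR.
have : b \in y f @: (~: (c @: R)).
  suff -> : y f @: (~: (c @: R)) = setT by rewrite inE.
  apply/eqP; rewrite eqEcard subsetT /= cardsT card_in_imset; last first.
    exact: coupled_ridge_inj.
  rewrite -(leq_add2l #|c @: R|) cardsC cA addnC leq_add2l -cR.
  by rewrite leq_imset_card.
by case/imsetP=> a /[!inE] aR ->; exists a.
Qed.

Lemma coupled_onto f b : #|A| = #|B| + d -> f \in F -> exists a, y f a = b.
Proof.
move=> cA fF; have /card_gt0P[v vf] : 0 < #|f| by rewrite cardF.
have [|a _ <-] := coupled_ridge_onto b cA fF (subD1set f v); last by exists a.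
by have := cardsD1 v f; rewrite vf cardF // add1n => -[].
Qed.

(* The class [y _ a] does not change along a walk until the color [a] occurs,
   so a walk meets this class and the color [a] at the same facet. *)
Lemma first_hit x s a : all (mem F) (x :: s) -> path (adj d) x s ->
  (forall g, g \in x :: s -> q g != y x a /\ a \notin c @: g) \/
  exists s1 g s2, [/\ x :: s = s1 ++ g :: s2, q g = y x a, a \in c @: g &
    forall h, h \in s1 -> q h != y x a /\ a \notin c @: h].
Proof.
elim: s x => [|z s IH] x /=; case/andP=> xF.
  move=> _ _; have [ax|ax] := boolP (a \in c @: x).
    right; exists [::], x, [::]; split=> //.
    by apply/esym/eqP; rewrite coupledE.
  by left=> g /[!inE] /eqP->; rewrite eq_sym coupledE.
move=> sF /andP[xz zs]; have [ax|ax] := boolP (a \in c @: x).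
  right; exists [::], x, (z :: s); split=> //.
  by apply/esym/eqP; rewrite coupledE.
have zF : z \in F by case/andP: sF.
have xz_a : y x a = y z a.
  apply: (coupled_adj cpl) => //.
  by apply: contra ax; apply/subsetP/imsetS/subsetIl.
have xE : q x != y z a /\ a \notin c @: x by rewrite -xz_a eq_sym coupledE.
rewrite xz_a.
case: (IH z sF zs) => [H | [s1 [g [s2 [e qg ag H]]]]].
  by left=> g /[1!inE] /predU1P[->|/H].
right; exists (x :: s1), g, s2; rewrite e; split=> //.
by move=> h /[1!inE] /predU1P[->|/H].
Qed.

End Coupled.

(** * Construction of couplings, one facet at a time *)

Section Existence.
Variables (T A B : finType) (d : nat).
Implicit Types (c : T -> A) (q : {set T} -> B) (y : {set T} -> A -> B).
Implicit Types (F : {set {set T}}) (f g R : {set T}) (a : A) (b : B).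

Lemma coupled_eq F c c' q q' y :
  {in F, forall f, {in f, c =1 c'}} -> {in F, q =1 q'} ->
  coupled d F c q y -> coupled d F c' q' y.
Proof.
move=> ec eq [inj on off ad]; split=> [f fF u w uf wf|f u fF uf|f a a' fF|f g a fF gF afg].
- by rewrite -!(ec f fF) //; apply: (inj f).
- by rewrite -(ec f fF) // on // eq.
- have e : c @: f = c' @: f by apply: eq_in_imset => u uf; apply: (ec f fF).
  by rewrite -e; apply: off.
- have e : c @: (f :&: g) = c' @: (f :&: g).
    by apply: eq_in_imset => u /setIP[uf _]; apply: (ec f fF).
  by rewrite -e; apply: ad.
Qed.

(** Exactly [#|B| - 1] colors are absent from [f]; they are injected into the classes other than
    [q f]. *)
Lemma coupled_set1 f c q : #|A| = #|B| + d -> #|f| = d.+1 ->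
  {in f &, injective c} -> exists y, coupled d [set f] c q y.
Proof.
move=> cA cf inj.
have cAf : #|~: (c @: f)| <= #|[set~ q f]|.
  rewrite cardsC1 -(leq_add2l #|c @: f|) cardsC card_in_imset // cA cf.
  have: 0 < #|B| by apply/card_gt0P; exists (q f).
  by move/prednK=> {1}<-; rewrite addSnnS addnC.
have [h [h_inj hq]] := exists_inj_into (q f) cAf.
exists (fun _ a => if a \in c @: f then q f else h a).
split=> [g /set1P->//|g u /set1P-> uf|g a a' /set1P->|g g' a /set1P-> /set1P->//].
  by rewrite imset_f.
case: ifP => af; case: ifP => a'f; first by right.
- by move=> e; have := hq a'; rewrite !inE a'f -e eqxx => /(_ isT).
- by move=> e; have := hq a; rewrite !inE af e eqxx => /(_ isT).
- by move/h_inj; rewrite !inE af a'f => /(_ isT isT); left.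
Qed.

(** The new facet sees the colors as [g] does, except that those of the ridge [f :\ v] get the class
    [q f]. The hypothesis [y g (c v) = q f] gives the new vertex's color this class as well. *)
Lemma coupled_setU1 F c q y f g v :
  (forall h, h \in F -> #|h| = d.+1) -> coupled d F c q y ->
  #|f| = d.+1 -> g \in F -> v \in f -> (forall h, h \in F -> v \notin h) ->
  f :\ v \subset g -> c v \notin c @: (f :\ v) -> y g (c v) = q f ->
  exists y', coupled d (f |: F) c q y'.
Proof.
move=> cardF cpl cf gF vf vF Rg cvR yv.
set R := f :\ v in Rg cvR.
have cR : #|R| = d by have := cardsD1 v f; rewrite vf cf add1n => -[].
have fE : f = v |: R by rewrite setD1K.
have fF : f \notin F by apply: contraL vf => /vF.
have nf h : h \in F -> (h == f) = false by move=> hF; apply: contraNF fF => /eqP <-.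
have cfE a : (a \in c @: f) = (a == c v) || (a \in c @: R).
  by rewrite fE imsetU1 !inE.
(* No facet of [F] contains [v], so those adjacent to [f] meet it in [R]. Each is [g] or adjacent to
   [g] along [R], where [y] already agrees off the colors of [R]. *)
have yadj h a : h \in F -> adj d f h -> a \notin c @: (f :&: h) ->
    (if a \in c @: R then q f else y g a) = y h a.
  move=> hF afh.
  have fhR : f :&: h = R.
    apply/eqP; rewrite eqEcard cR (eqP afh) leqnn andbT subsetD1 subsetIl.
    by rewrite inE negb_and (vF h hF) orbT.
  rewrite fhR => aR; rewrite (negPf aR).
  have [->//|gh] := eqVneq g h.
  have ghR : g :&: h = R.
    apply: (setI_ridge (d := d)) => //; rewrite ?cardF //.
    by rewrite -fhR subsetIr.
  by apply: (coupled_adj cpl); rewrite // /adj ghR ?cR.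
exists (fun h a => if h == f then if a \in c @: R then q f else y g a else y h a).
split=> [h|h u|h a a'|h h' a].
- case/setU1P=> [-> u w|hF]; last exact: (coupled_inj cpl hF).
  rewrite {1 2}fE => /setU1P[->|uR] /setU1P[->|wR] //.
  + by move=> e; rewrite e imset_f in cvR.
  + by move=> e; rewrite -e imset_f in cvR.
  + by apply: (coupled_inj cpl gF); apply: (subsetP Rg).
- case/setU1P=> [->|hF]; last by rewrite nf //; apply: (coupled_on cpl hF).
  by rewrite eqxx {1}fE => /setU1P[->|uR]; rewrite ?(negPf cvR) // imset_f.
- case/setU1P=> [->|hF]; last by rewrite nf //; apply: (coupled_off cpl hF).
  (* Off the colors of [R], [y g] is injective and takes the value [q f] at [c v], so no further
     color gets the class of [f]. *)
  have inj := coupled_ridge_inj cardF cpl gF Rg cR.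
  rewrite eqxx !cfE; case: ifP => aR; case: ifP => a'R.
  + by rewrite !orbT; right.
  + by rewrite -yv => /inj-> //; rewrite ?inE ?a'R //; right; rewrite eqxx !orbT.
  + by rewrite -yv => /inj-> //; rewrite ?inE ?aR //; right; rewrite eqxx !orbT.
  + by move=> /inj; rewrite !inE aR a'R => /(_ isT isT); left.
- case/setU1P=> [->|hF] /setU1P[->|h'F] //; rewrite ?eqxx ?nf //.
  + exact: yadj.
  + by rewrite adj_sym setIC => ? ?; apply/esym/yadj.
  + exact: (coupled_adj cpl).
Qed.

End Existence.

(** * Stacked complexes: colorings, connectedness and paths *)

Section Stacked.
Variables (T : finType) (X : {set {set T}}) (d : nat).
Hypothesis pureX : pure X d.
Hypothesis stackedX : stacked X.
Implicit Types (f g h : {set T}) (F : {set {set T}}).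

Lemma facetsE f : (f \in facets X) = is_facet X f.
Proof. by rewrite inE. Qed.

Lemma card_facet f : f \in facets X -> #|f| = d.+1.
Proof. by rewrite facetsE; apply: pureX. Qed.

(** Induction along the prefixes of the stacking order, taken as sets of facets; [v] is the new
    vertex and [g] an earlier facet containing the rest of [f]. *)
Lemma stacked_ind (P : {set {set T}} -> Prop) :
  (forall f, #|f| = d.+1 -> P [set f]) ->
  (forall F f g v, P F -> (forall h, h \in F -> #|h| = d.+1) ->
     f \in facets X -> F \subset facets X -> #|f| = d.+1 -> g \in F ->
     v \in f -> (forall h, h \in F -> v \notin h) -> f :\ v \subset g ->
     P (f |: F)) ->
  P (facets X).
Proof.
move=> P1 PU; have [_ [_ [s [s0 _ sX sP]]]] := stackedX.
have sF p : p < size s -> nth set0 s p \in facets X.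
  by move=> ps; rewrite facetsE; apply/sX/mem_nth.
have -> : facets X = [set f in take (size s) s].
  by rewrite take_size; apply/setP=> f; rewrite !inE; apply/idP/idP=> /sX.
suff H n : n < size s -> P [set f in take n.+1 s].
  by rewrite -(prednK s0); apply: H; rewrite prednK.
elim: n => [_|n IH ns].
  have -> : [set f in take 1 s] = [set nth set0 s 0].
    by rewrite (take_nth set0) // take0; apply/setP=> f; rewrite !inE.
  by apply/P1/card_facet/sF.
have mem_tk h : h \in take n.+1 s -> exists2 j, j < n.+1 & h = nth set0 s j.
  move=> /(nthP set0)[j]; rewrite size_takel ?(ltnW ns) // => jn <-.
  by exists j; rewrite ?nth_take.
have -> : [set f in take n.+2 s] = nth set0 s n.+1 |: [set f in take n.+1 s].
  by rewrite (take_nth set0) //; apply/setP=> f; rewrite !inE mem_rcons inE.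
have [v [vE [j jn Rj]]] := sP n.+1 ns.
have : v \in [set v] by rewrite inE.
rewrite -vE inE => /andP[vs vN].
have tF h : h \in take n.+1 s -> h \in facets X.
  by move=> /mem_tk[i /ltnW il ->]; apply/sF/(leq_trans _ ns).
apply: (PU _ _ (nth set0 s j) v) => //; rewrite ?card_facet ?sF //.
- exact/IH/ltnW.
- by move=> h /[1!inE] /tF/card_facet.
- by apply/subsetP=> h /[1!inE] /tF.
- by rewrite inE -(nth_take set0 jn) mem_nth // size_takel // ltnW.
- move=> h /[1!inE] /mem_tk[i il ->]; apply: contra vN => vi.
  by apply/bigcupP; exists (Ordinal il).
Qed.

(** The first facet gets the arbitrary class [b0]; the color of the new vertex then dictates the
    class of each later facet. *)
Lemma exists_facet_coloring (A B : finType) (c : T -> A) (b0 : B) :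
  #|A| = #|B| + d -> (forall f, f \in facets X -> {in f &, injective c}) ->
  exists (q : {set T} -> B) y, coupled d (facets X) c q y.
Proof.
move=> cA; pose P F := (forall f, f \in F -> {in f &, injective c}) ->
  exists (q : {set T} -> B) y, coupled d F c q y.
apply: (stacked_ind (P := P)) => [f cf inj|F f g v IH cF _ _ cf gF vf vF Rg inj].
  by exists (fun _ => b0); apply: coupled_set1 => //; apply: inj; rewrite inE.
have [|q [y cpl]] := IH; first by move=> h hF; apply: inj; rewrite inE hF orbT.
pose q' h := if h == f then y g (c v) else q h.
exists q'; apply: (coupled_setU1 (F := F) (g := g) (v := v) (y := y)) => //.
- apply: coupled_eq cpl => // h hF; rewrite /q'; case: eqP => // hf.
  by have := vF h hF; rewrite hf vf.
- apply/imsetP=> -[u /setD1P[uv uf]] /(inj f (setU11 _ _) v u vf uf) vu.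
  by rewrite vu eqxx in uv.
- by rewrite /q' eqxx.
Qed.

(** Here the class of the new facet dictates the color of its new vertex: [coupled_ridge_onto]
    provides a color, absent from the ridge, that [g] sees as this class. *)
Lemma exists_vertex_coloring (A B : finType) (q : {set T} -> B) :
  #|A| = #|B| + d -> exists (c : T -> A) y, coupled d (facets X) c q y.
Proof.
move=> cA; have B0 : 0 < #|B| by apply/card_gt0P; exists (q set0).
have A0 : 0 < #|A| by rewrite cA addn_gt0 B0.
case/card_gt0P: A0 => a0 _.
apply: (stacked_ind (P := fun F => exists (c : T -> A) y, coupled d F c q y)).
  move=> f cf; have [|c [inj _]] := @exists_inj_into _ _ a0 f setT.
    by rewrite cardsT cA cf -add1n leq_add2r.
  by exists c; apply: coupled_set1.
move=> F f g v [c [y cpl]] cF _ _ cf gF vf vF Rg.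
have cR : #|f :\ v| = d by have := cardsD1 v f; rewrite vf cf add1n => -[].
have [a aR ya] := coupled_ridge_onto cF cpl (q f) cA gF Rg cR.
pose c' u := if u == v then a else c u.
exists c'; apply: (coupled_setU1 (F := F) (g := g) (v := v) (y := y)) => //.
- apply: coupled_eq cpl => // h hF u uh; rewrite /c'; case: eqP => // uv.
  by have := vF h hF; rewrite -uv uh.
- rewrite {1}/c' eqxx; suff -> : c' @: (f :\ v) = c @: (f :\ v) by [].
  by apply: eq_in_imset => u /setD1P[/negPf uv _]; rewrite /c' uv.
- by rewrite /c' eqxx.
Qed.

Let e := [rel f g : {set T} | [&& f \in facets X, g \in facets X & adj d f g]].

Lemma facets_connected f g : f \in facets X -> g \in facets X -> connect e f g.
Proof.
have sym : connect_sym e.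
  by apply: sym_connect_sym => h h'; rewrite /= adj_sym andbCA.
pose P F := forall f g, f \in F -> g \in F -> connect e f g.
apply: (stacked_ind (P := P)) => [h _ f' g' /set1P-> /set1P->//|].
move=> F h g' v IH cF hF FX ch gF vh vF Rg.
have hg : connect e h g'.
  apply: connect1; rewrite /= hF (subsetP FX) //= /adj.
  have cR : #|h :\ v| = d by have := cardsD1 v h; rewrite vh ch add1n => -[].
  rewrite -cR; apply/eqP; congr #|pred_of_set _|; apply/eqP.
  by rewrite eqEsubset subsetD1 subsetIl inE vh (negPf (vF g' gF)) subsetI subD1set Rg.
have hF' h' : h' \in F -> connect e h h'.
  by move=> h'F; apply: connect_trans hg (IH _ _ _ _).
move=> x z /setU1P[->|xF] /setU1P[->|zF] //; first exact: hF'.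
- by rewrite sym; apply: hF'.
- exact: IH.
Qed.

(** When a ridge of [f] occurs on a walk, [f] can step directly to the facet just behind that ridge,
    and all that comes before is dropped. *)
Lemma path_shortcut (R f x : {set T}) (s : seq {set T}) : #|R| = d -> R \subset f -> f \in facets X ->
  all (mem (facets X)) (x :: s) -> path (adj d) x s -> uniq (ridges (x :: s)) ->
  R \in ridges (x :: s) ->
  exists s', [/\ all (mem (facets X)) (f :: s'), path (adj d) f s',
    last f s' = last x s & uniq (ridges (f :: s'))].
Proof.
move=> cR Rf fF; elim: s x => [//|z s IH] x.
rewrite [all _ _]/=; case/and3P=> xF zF sF; rewrite [path _ _ _]/= => /andP[xz zs].
have -> : ridges (x :: z :: s) = (x :&: z) :: ridges (z :: s) by [].
rewrite cons_uniq => /andP[nin un]; rewrite inE => /predU1P[RE|]; last first.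
  by apply: IH => //=; rewrite zF.
have [fz|fz] := eqVneq f z.
  by exists s; rewrite fz /= zF sF.
have fzR : f :&: z = R.
  apply: (setI_ridge (d := d)) => //; rewrite ?card_facet //.
  by rewrite RE subsetIr.
exists (z :: s); split=> //=; first by rewrite fF zF.
- by rewrite zs /adj fzR cR eqxx.
- by rewrite fzR RE; apply/andP.
Qed.

(** Facets are put in front of the walk one at a time; when the new ridge already occurs further on,
    [path_shortcut] removes the repetition. *)
Lemma exists_path f g : f \in facets X -> g \in facets X ->
  exists s, [/\ all (mem (facets X)) (f :: s), path (adj d) f s,
    last f s = g & uniq (ridges (f :: s))].
Proof.
move=> fF gF; have /connectP[s es ->] := facets_connected fF gF.
elim: s f fF es => [|z s IH] f fF /=; first by exists [::]; rewrite /= fF.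
case/andP=> /and3P[_ zF afz] /(IH z zF)[s' [s'F zs' <- us']].
have [Rin|Rnin] := boolP (f :&: z \in ridges (z :: s')).
  by apply: path_shortcut Rin; rewrite ?(eqP afz) ?subsetIl.
exists (z :: s'); split=> //=; last by apply/andP.
- by rewrite fF.
- by rewrite afz.
Qed.

(* Coupling the identity coloring of the facets turns a class met again into the
   facet [f] itself. *)
Lemma walk_return f g s v : f \in facets X -> all (mem (facets X)) (g :: s) ->
  adj d f g -> path (adj d) g s -> v \in f -> v \notin g -> v \in last g s ->
  f \in g :: s.
Proof.
move=> fF sF afg gs vf vg vl.
have [c [y cpl]] := @exists_vertex_coloring 'I_(#|{set T}| + d) _ id (card_ord _).
have gF : g \in facets X by case/andP: sF.
have yg := coupled_step cpl fF gF afg vf vg.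
case: (first_hit card_facet cpl (c v) sF gs) => [H|[s1 [h [s2 [-> hf _ _]]]]].
  by have [_] := H _ (mem_last _ _); rewrite imset_f.
by rewrite mem_cat inE -yg -hf eqxx orbT.
Qed.

End Stacked.

(** * Transfer between the vertex partition and the facet partition of a coupling *)

Section Transfer.
Variables (T A B : finType) (X : {set {set T}}) (d : nat).
Variables (c : T -> A) (q : {set T} -> B) (y : {set T} -> A -> B).
Hypothesis pureX : pure X d.
Hypothesis stackedX : stacked X.
Hypothesis coverX : forall v, exists2 f, f \in facets X & v \in f.
Hypothesis cpl : coupled d (facets X) c q y.
Implicit Types (f g h : {set T}) (s : seq {set T}).

Let VP := preim_partition c [set: T].
Let FQ := preim_partition q (facets X).
Let cardF := card_facet pureX.

Lemma exists_facet : exists f, f \in facets X.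
Proof.
have [_ [_ [[|f s] [//= _ _ sX _]]]] := stackedX.
by exists f; rewrite facetsE; apply/sX; rewrite inE eqxx.
Qed.

Lemma color_inj f u v : f \in facets X -> u \in f -> v \in f -> c u = c v -> u = v.
Proof. by move=> fF; apply: (coupled_inj cpl fF). Qed.

Lemma walk_cat f s1 g s2 :
  all (mem (facets X)) (f :: s1 ++ g :: s2) -> path (adj d) f (s1 ++ g :: s2) ->
  [/\ all (mem (facets X)) (f :: rcons s1 g), path (adj d) f (rcons s1 g),
      all (mem (facets X)) (g :: s2) & path (adj d) g s2].
Proof.
rewrite -cat_rcons -cat_cons all_cat cat_path last_rcons => /andP[h1 h2] /andP[p1 p2].
split=> //=; rewrite h2 andbT; apply: (allP h1).
by rewrite inE mem_rcons inE eqxx orbT.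
Qed.

(** Seen from [x], the color [c v] has the class [q f], so by [first_hit] both occur first at the
    same facet [g]. Since [u] is outside the preceding facet, it is the vertex opposite to the last
    ridge crossed, as [phi_rel] and [psi_rel] require. *)
Lemma walk_leave f x s v : all (mem (facets X)) (f :: x :: s) ->
  path (adj d) f (x :: s) -> v \in f -> v \notin x ->
  (exists2 h, h \in x :: s & q h = q f \/ c v \in c @: h) ->
  exists s1 g s2 u, [/\ x :: s = s1 ++ g :: s2, q g = q f, u \in g /\ c v = c u,
    u \notin last f s1 & forall h, h \in s1 -> q h != q f /\ c v \notin c @: h].
Proof.
move=> /andP[fF sF] /andP[fx xs] vf vx [h0 h0s hit].
have xF : x \in facets X by case/andP: sF.
have yx := coupled_step cpl fF xF fx vf vx.
case: (first_hit cardF cpl (c v) sF xs) => [H|[s1 [g [s2 [e qg /imsetP[u ug cvu] H]]]]].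
  have [] := H h0 h0s; rewrite yx => /eqP ? vh.
  by case: hit => // vh'; rewrite vh' in vh.
rewrite yx in qg H; exists s1, g, s2, u; split=> //.
(* If [g] directly follows [f], a vertex [u] in [f] would equal [v], which is not in [g]; otherwise
   the facet before [g] lacks the color of [u]. *)
case: (lastP s1) e H => [|s1' z] e H.
  apply/negP=> uf; move: vx; case: e => -> _.
  by rewrite (color_inj fF vf uf cvu) ug.
have [|_ zc] := H z; first by rewrite mem_rcons inE eqxx.
by rewrite last_rcons; apply: contra zc => uz; rewrite cvu imset_f.
Qed.

Lemma nth1_rcons (z0 f g : {set T}) s1 x s s2 : x :: s = s1 ++ g :: s2 ->
  nth z0 (f :: rcons s1 g) 1 = x.
Proof. by case: s1 => [|? ?] [->]. Qed.

Lemma nth_penultimate (z0 f g : {set T}) s1 :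
  nth z0 (f :: rcons s1 g) (size (f :: rcons s1 g)).-2 = last f s1.
Proof.
by rewrite (last_nth z0) /= size_rcons /= -rcons_cons nth_rcons /= ltnSn.
Qed.

Lemma inner_cons2 f g s : inner [:: f, g & s] = belast g s.
Proof.
by rewrite /inner /= -[size s](size_belast g) lastI -cats1 take_size_cat.
Qed.

Lemma inner_rcons f g s1 : inner (f :: rcons s1 g) = s1.
Proof. by rewrite /inner /= size_rcons /= -cats1 take_size_cat. Qed.

Lemma fpath_rcons f s1 g s2 :
  all (mem (facets X)) (f :: s1 ++ g :: s2) -> path (adj d) f (s1 ++ g :: s2) ->
  uniq (ridges (f :: s1 ++ g :: s2)) -> Defs.fpath X d (f :: rcons s1 g).
Proof.
move=> sF fs /uniq_ridges_cat[us _]; have [s1F p1 _ _] := walk_cat sF fs.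
rewrite /Defs.fpath us /walk p1 !andbT.
by apply: sub_all s1F => h; rewrite /= facetsE.
Qed.

Lemma walkE f s : walk X d (f :: s) ->
  all (mem (facets X)) (f :: s) /\ path (adj d) f s.
Proof.
rewrite /walk => /andP[sF ->]; split=> //.
by apply: sub_all sF => h; rewrite /= facetsE.
Qed.

Lemma prefix_of_last (x g : {set T}) s s1 s2 : x :: s = s1 ++ g :: s2 ->
  g \notin belast x s -> s2 = [::] /\ s1 = belast x s.
Proof.
rewrite lastI; case: (lastP s2) => [|s2' z].
  by rewrite cats1 => /rcons_inj[<- _].
rewrite -rcons_cons -rcons_cat => /rcons_inj[-> _].
by rewrite mem_cat inE eqxx orbT.
Qed.

(** The first facet past [f] that has the color of [v] also has the class of [f]. The inner facets
    avoid [P], so this facet is [f']. *)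
Lemma phi_rel_color f f' : phi_rel X d VP f f' -> q f = q f'.
Proof.
case=> _ _ ff' [[|z [|x s]] [ws]]; first by [].
  by move=> /= zf zf'; rewrite -zf -zf' eqxx in ff'.
case/andP: ws => /walkE[sF zs] _ zf xl [P PV [v [w [vP wP fE f'E dP]]]].
rewrite /= in zf xl; rewrite zf in sF zs.
have /andP[vx vf] : (v \notin x) && (v \in f) by rewrite -in_setD fE inE.
have PE := preim_partition_block PV vP.
have : w \in f' by move: (set11 w); rewrite -f'E => /setDP[].
move: wP; rewrite PE inE => /andP[_ /eqP cvw] wf'.
have [|s1 [g [s2 [u [e qg [ug cvu] _ _]]]]] := walk_leave sF zs vf vx.
  by exists f'; [rewrite -xl mem_last | right; rewrite cvw imset_f].
rewrite -qg; congr q; have : g \in x :: s by rewrite e mem_cat inE eqxx orbT.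
rewrite lastI mem_rcons inE xl => /predU1P[//|gb].
have gi : g \in inner [:: z, x & s] by rewrite inner_cons2.
by have := disjointFr (allP dP g gi) ug; rewrite PE !inE cvu eqxx.
Qed.

(** A path to [f'] is cut at its successive facets of class [q f]; consecutive ones are equal or
    related by [phi_rel]. *)
Lemma color_phi_rel f f' : f \in facets X -> f' \in facets X -> q f = q f' ->
  clos_refl_sym_trans _ (phi_rel X d VP) f f'.
Proof.
move=> fF f'F; have [s [sF fs <- us]] := exists_path pureX stackedX fF f'F.
elim: {s}_.+1 {-2}s (ltnSn (size s)) f fF sF fs us {f' f'F} => // n IH s sn f fF.
case: s sn => [|x s] sn sF fs us qE; first exact: rst_refl.
have /andP[fx _] := fs.
have [v fxE] := adj_diff (cardF fF) fx.
have /andP[vx vf] : (v \notin x) && (v \in f) by rewrite -in_setD fxE inE.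
have [|s1 [g [s2 [u [e qg [ug cvu] ul H]]]]] := walk_leave sF fs vf vx.
  by exists (last x s); [apply: mem_last | left].
rewrite [last _ _]/= -/(last x (x :: s)) in qE *.
have lastE : last x s = last g s2.
  by rewrite -[last x s]/(last x (x :: s)) e last_cat.
rewrite e in sF fs us sn.
have [s1F p1 s2F p2] := walk_cat sF fs.
have gF : g \in facets X by case/andP: s2F.
have [_ us2] := uniq_ridges_cat us.
apply: (rst_trans _ _ _ g); last first.
  rewrite lastE; apply: IH => //; last by rewrite qg -lastE.
  by move: sn; rewrite size_cat /= addnS ltnS; apply: leq_trans; rewrite ltnS leq_addl.
have [->|fg] := eqVneq f g; first exact: rst_refl.
apply: rst_step; split; rewrite -?facetsE //.
exists (f :: rcons s1 g); split=> //; [exact: fpath_rcons us|by rewrite /= last_rcons|].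
exists [set w in setT | c v == c w]; first by apply: mem_preim_partition; rewrite inE.
exists v, u; split; rewrite ?inE ?cvu ?eqxx //.
- by rewrite (nth1_rcons _ _ e).
- rewrite nth_penultimate; apply: (adj_diffE (d := d)) => //; first exact: cardF.
  by rewrite adj_sym; move: p1; rewrite rcons_path => /andP[].
- rewrite inner_rcons; apply/allP=> h hs1.
  have [_ hv] := H h hs1; rewrite disjoints_subset; apply/subsetP=> w wh.
  by rewrite !inE; apply: contra hv; rewrite cvu => /eqP->; apply: imset_f.
Qed.

(** The color of [v] recurs first at a facet in the class of the initial one, which can only be the
    last facet. There the recurring vertex and [w] are both opposite to the last ridge, hence
    equal. *)
Lemma psi_rel_color v w : psi_rel X d FQ v w -> c v = c w.
Proof.
case=> vw /existsPn nf [[|f [|x s]] [ws]]; first by [].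
  case/andP: ws => /walkE[/andP[fF _] _] _ vf wf.
  by have := nf f; rewrite -facetsE [f \in _]fF vf wf.
case/andP: ws => /walkE[sF fs] _ vf wl /(_ isT)[vN wN] [Q QF [fQ lQ iQ]].
have fF : f \in facets X by case/andP: sF.
have vx : v \notin x by move: vN; rewrite inE vf.
have QE := preim_partition_block QF fQ.
have qE : q (last x s) = q f by move: lQ; rewrite QE inE => /andP[_ /eqP].
have [|s1 [g [s2 [u [e qg [ug cvu] ul H]]]]] := walk_leave sF fs vf vx.
  by exists (last x s); [apply: mem_last | left].
rewrite cvu; congr c.
have gF : g \in facets X.
  by apply: (allP sF); rewrite inE e mem_cat inE eqxx !orbT.
have [|s20 s1E] := prefix_of_last e.
  apply/negP; rewrite -(inner_cons2 f) => /(allP iQ).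
  by rewrite QE inE gF qg eqxx.
have lE : last x s = g by rewrite -[last x s]/(last x (x :: s)) e s20 last_cat.
have pE : nth set0 [:: f, x & s] (size s) = last f s1.
  have rE : rcons s1 g = x :: s by rewrite e s20 cats1.
  by have := nth_penultimate set0 f g s1; rewrite rE.
rewrite /= lE in wl wN; move: wN; rewrite inE wl pE => wN.
have adg : adj d g (last f s1).
  by rewrite adj_sym; move: fs; rewrite e cat_path => /and3P[].
apply: set1_inj; rewrite -(adj_diffE (cardF gF) adg ug ul).
exact: (adj_diffE (cardF gF) adg wl wN).
Qed.

(** The initial facet is dropped as long as the next one contains [v]. Once [v] is left, the path is
    cut at the next facet having its color: the vertex [u] of this color there is [v] or related to
    it, and the rest of the path links [u] to [w]. *)
Lemma color_psi_rel v w : c v = c w ->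
  clos_refl_sym_trans _ (psi_rel X d FQ) v w.
Proof.
have [f fF vf] := coverX v; have [f' f'F] := coverX w.
have [s [sF fs <- us]] := exists_path pureX stackedX fF f'F => {f' f'F}.
elim: {s}_.+1 {-2}s (ltnSn (size s)) f v fF vf sF fs us => // n IH s sn f v fF vf.
case: s sn => [|x s] sn sF fs us wl cvw.
  by rewrite (color_inj fF vf wl cvw); apply: rst_refl.
have /andP[_ sF'] := sF; have /andP[_ fs'] := fs.
have xF : x \in facets X by case/andP: sF'.
have [vx|vx] := boolP (v \in x).
  by have [_ us'] := uniq_ridges_cat (s1 := [::]) us; apply: (IH s sn x).
have [|s1 [g [s2 [u [e qg [ug cvu] ul H]]]]] := walk_leave sF fs vf vx.
  by exists (last x s); [apply: mem_last | right; rewrite cvw imset_f].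
have lastE : last f (x :: s) = last g s2 by rewrite e last_cat.
rewrite e in sF fs us sn; rewrite lastE in wl.
have [s1F p1 s2F p2] := walk_cat sF fs.
have gF : g \in facets X by case/andP: s2F.
have [_ us2] := uniq_ridges_cat us.
apply: (rst_trans _ _ _ u); last first.
  apply: (IH s2 _ g) => //; last by rewrite -cvu.
  by move: sn; rewrite size_cat /= addnS ltnS; apply: leq_trans; rewrite ltnS leq_addl.
have [->|vu] := eqVneq v u; first exact: rst_refl.
apply: rst_step; split=> //.
  apply/existsPn=> h; apply/negP=> /and3P[]; rewrite -facetsE => hF vh uh.
  by rewrite (color_inj hF vh uh cvu) eqxx in vu.
exists (f :: rcons s1 g); split=> //.
- exact: fpath_rcons us.
- by rewrite /= last_rcons.
- move=> _; rewrite (nth1_rcons _ _ e) nth_penultimate !inE (negPf vx) (negPf ul).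
  by rewrite !andbF.
rewrite [last _ _]/= last_rcons.
exists [set h in facets X | q f == q h]; first exact: mem_preim_partition.
rewrite !inE -?facetsE fF gF qg !eqxx; split=> //.
rewrite inner_rcons; apply/allP=> h /H[qh _].
by rewrite inE negb_and eq_sym qh orbT.
Qed.

(** Together with [Psi_color] this gives both inverse laws at once: the two maps exchange the fibers
    of [c] and those of [q]. *)
Lemma Phi_color : Phi X d VP = FQ.
Proof.
apply: eq_in_imset => f fF; apply/setP=> g; rewrite !inE.
case gF : (is_facet X g) => //=; apply/asboolP/eqP => [|e]; last first.
  by apply: color_phi_rel => //; rewrite facetsE.
by elim=> {fF gF f g} [f g /phi_rel_color | | f g _ -> | f g h _ -> _ ->].
Qed.

Lemma Psi_color : Psi X d FQ = VP.
Proof.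
have E v : [set w | `[< clos_refl_sym_trans _ (psi_rel X d FQ) v w >]] =
    [set w in [set: T] | c v == c w].
  apply/setP=> w; rewrite !inE /=.
  apply/asboolP/eqP => [|e]; last exact: color_psi_rel.
  by elim=> {v w} [v w /psi_rel_color | | v w _ -> | u v w _ -> _ ->].
by apply/setP=> P; apply/imsetP/imsetP=> -[v _ ->]; exists v.
Qed.

(** A bound [sc.+1] on the number of facets of a walk is a bound [sc] on its number of steps, so it
    suffices to find within the walk a walk between distinct facets of one class. *)
Lemma vertices_scattered_color sc : (forall Q, Q \in FQ -> facets_scattered X d sc Q) ->
  forall P, P \in VP -> vertices_scattered X d sc.+1 P.
Proof.
move=> scQ P PV v w vP wP vw [//|f s] /walkE[sF fs] /= vf wl; rewrite ltnS.
have {P PV vP wP} cvw : c v = c w.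
  by move: wP; rewrite (preim_partition_block PV vP) !inE => /eqP.
elim: {s}_.+1 {-2}s (ltnSn (size s)) f v vf sF fs wl vw cvw => // n IH s sn f v vf.
case: s sn => [|x s] sn sF fs wl vw cvw.
  have fF : f \in facets X by case/andP: sF.
  by rewrite (color_inj fF vf wl cvw) eqxx in vw.
have /andP[_ sF'] := sF; have /andP[_ fs'] := fs.
have [vx|vx] := boolP (v \in x).
  by apply: leqW; apply: (IH s _ x v).
have [|s1 [g [s2 [u [e qg [ug cvu] ul H]]]]] := walk_leave sF fs vf vx.
  by exists (last x s); [apply: mem_last | right; rewrite cvw imset_f].
have lastE : last f (x :: s) = last g s2 by rewrite e last_cat.
rewrite [last _ _]lastE in wl; rewrite e in sF fs sn *.
have [s1F p1 s2F p2] := walk_cat sF fs.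
have gF : g \in facets X by case/andP: s2F.
have fF : f \in facets X by case/andP: sF.
(* The walk may come back to [v] itself; the argument then resumes from [g]. *)
have [uv|vu] := eqVneq v u.
  rewrite size_cat /= addnS; apply/leqW/(leq_trans _ (leq_addl _ _)).
  apply: (IH s2 _ g v) => //; last by rewrite uv.
  by move: sn; rewrite size_cat /= addnS ltnS; apply: leq_trans; rewrite ltnS leq_addl.
have fg : f != g.
  by apply: contra vu => /eqP fg; rewrite fg in vf; rewrite (color_inj gF vf ug cvu).
have := scQ _ (mem_preim_partition q fF) f g.
rewrite !inE -!facetsE fF gF qg !eqxx => /(_ isT isT fg (f :: rcons s1 g)).
rewrite /= last_rcons size_rcons p1 andbT => /(_ _ erefl erefl) scs.
rewrite size_cat /= addnS; apply: leq_trans (scs _) _; last by rewrite ltnS leq_addr.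
by apply: sub_all s1F => h; rewrite /= facetsE.
Qed.

(** The stretch from [f] to the next facet [g] of its class joins two vertices of one color; if [g]
    is [f], the argument resumes from there. *)
Lemma facets_scattered_color sc : (forall P, P \in VP -> vertices_scattered X d sc.+1 P) ->
  forall Q, Q \in FQ -> facets_scattered X d sc Q.
Proof.
move=> scP Q QF f f' fQ f'Q ff' [//|z s] /walkE[sF fs] /= zf lE.
rewrite zf in sF fs lE.
have {Q QF fQ f'Q} qE : q f = q f'.
  by move: f'Q; rewrite (preim_partition_block QF fQ) inE => /andP[_ /eqP].
elim: {s}_.+1 {-2}s (ltnSn (size s)) sF fs lE {zf} => // n IH s sn.
case: s sn => [|x s] sn sF fs lE; first by rewrite -lE eqxx in ff'.
have /andP[fF sF'] := sF; have /andP[fx fs'] := fs.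
have [v fxE] := adj_diff (cardF fF) fx.
have /andP[vx vf] : (v \notin x) && (v \in f) by rewrite -in_setD fxE inE.
have [|s1 [g [s2 [u [e qg [ug cvu] ul H]]]]] := walk_leave sF fs vf vx.
  by exists (last x s); [apply: mem_last | left; rewrite qE -lE].
have lastE : last f (x :: s) = last g s2 by rewrite e last_cat.
rewrite [last _ _]lastE in lE; have e' := e; rewrite e in sF fs sn *.
have [s1F p1 s2F p2] := walk_cat sF fs.
have [fg|fg] := eqVneq f g.
  rewrite size_cat /= addnS; apply/leqW/(leq_trans _ (leq_addl _ _)).
  apply: (IH s2); rewrite ?fg //.
  by move: sn; rewrite size_cat /= addnS ltnS; apply: leq_trans; rewrite ltnS leq_addl.
(* By [walk_return], a walk that leaves [v] and comes back to it passes through [f] again, but no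
   facet of [s1] has the class of [f]. *)
have vu : v != u.
  apply/eqP=> vu; rewrite -vu in ug.
  have [x' [s' xE]] : exists x' s', rcons s1 g = x' :: s'.
    by case: (s1) => [|a l]; [exists g, [::] | exists a, (rcons l g)].
  have xx' : x = x'.
    by have := nth1_rcons set0 f e'; rewrite xE.
  have : f \in x' :: s'.
    move: s1F p1; rewrite xE => /andP[_ s1F] /andP[fx' p1].
    apply: (walk_return pureX stackedX fF s1F fx' p1 vf); rewrite -?xx' //.
    by rewrite xx' -[last _ _]/(last f (x' :: s')) -xE last_rcons.
  rewrite -xE mem_rcons inE (negPf fg) /= => /H[].
  by rewrite eqxx.
have := scP _ (mem_preim_partition c (in_setT v)) v u.
rewrite !inE cvu !eqxx => /(_ isT isT vu (f :: rcons s1 g)).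
rewrite /= last_rcons size_rcons p1 andbT => scs.
rewrite size_cat /= addnS; apply: (@leq_trans (size s1).+1); last by rewrite ltnS leq_addr.
by apply: scs => //; apply: sub_all s1F => h; rewrite /= facetsE.
Qed.

(** The class [b] is some color [a] seen from [f0]; a path to a facet with a vertex of color [a]
    meets the class [b] where it first meets [a]. *)
Lemma facet_color_onto : #|A| = #|B| + d -> c @: [set: T] = setT ->
  q @: facets X = setT.
Proof.
move=> cA c_onto; have [f0 f0F] := exists_facet.
apply/setP=> b; rewrite inE; have [a ya] := coupled_onto cardF cpl b cA f0F.
have : a \in c @: [set: T] by rewrite c_onto inE.
case/imsetP=> u _ au; have [f fF uf] := coverX u.
have [s [sF fs lE _]] := exists_path pureX stackedX f0F fF.
case: (first_hit cardF cpl a sF fs) => [H|[s1 [g [s2 [e qg _ _]]]]].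
  by have [_] := H _ (mem_last _ _); rewrite lE au imset_f.
rewrite -ya -qg imset_f //; apply: (allP sF).
by rewrite e mem_cat inE eqxx orbT.
Qed.

Lemma vertex_color_onto : q @: facets X = setT -> c @: [set: T] = setT.
Proof.
move=> q_onto; have [f0 f0F] := exists_facet.
apply/setP=> a; rewrite inE.
have : y f0 a \in q @: facets X by rewrite q_onto inE.
case/imsetP=> f fF qf.
have [s [sF fs lE _]] := exists_path pureX stackedX f0F fF.
case: (first_hit cardF cpl a sF fs) => [H|[s1 [g [s2 [_ _ /imsetP[u _ ->] _]]]]].
  by have [] := H _ (mem_last _ _); rewrite lE qf eqxx.
by rewrite imset_f.
Qed.

End Transfer.

Theorem theorem3p6 (T : finType) (X : {set {set T}}) (d r s : nat) :
  is_simplicial_complex X -> pure X d -> stacked X -> 1 <= r -> 1 <= s ->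
  (forall VP : {set {set T}}, vertex_partition_ok X d (r + d) s.+1 VP ->
     facet_partition_ok X d r s (Phi X d VP) /\ Psi X d (Phi X d VP) = VP) /\
  (forall FQ : {set {set {set T}}}, facet_partition_ok X d r s FQ ->
     vertex_partition_ok X d (r + d) s.+1 (Psi X d FQ) /\ Phi X d (Psi X d FQ) = FQ).
Proof.
(* Writing [r] as a successor makes both color sets nonempty ordinals, so that [partition_coloring]
   applies and [ord0] exists. *)
move=> [_ cov] pureX stX; case: r => // r _ s_gt0.
have coverX v : exists2 f, f \in facets X & v \in f.
  have [g gX vg] := cov v.
  have [f /maxsetP[fX fmax] gf] := maxset_exists (P := mem X) gX.
  exists f; last exact: (subsetP gf).
  rewrite facetsE /is_facet -[f \in X]/(mem X f) fX; apply/forallP=> h.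
  by apply/implyP=> /andP[hX fh]; apply/eqP/fmax.
have cA : #|'I_(r + d).+1| = #|'I_r.+1| + d by rewrite !card_ord.
split=> [VP [partV cardV scV]|FQ [partF cardF scF]].
  have [c cV c_onto] := partition_coloring partV cardV.
  (* A walk made of one facet is too short for the bound [s.+1], which is at least 2, so the
     vertices of a facet lie in distinct parts. *)
  have c_inj f : f \in facets X -> {in f &, injective c}.
    move=> fF u v uf vf cuv; apply/eqP/contraT=> uv.
    have PV := mem_preim_partition c (in_setT u); rewrite cV in PV.
    have := scV _ PV u v; rewrite !inE cuv !eqxx => /(_ isT isT uv [:: f]).
    rewrite /walk /= -facetsE fF => /(_ isT uf vf).
    by rewrite ltnS leqNgt s_gt0.
  have [q [y cpl]] := exists_facet_coloring pureX stX (@ord0 r) cA c_inj.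
  have q_onto := facet_color_onto pureX stX coverX cpl cA c_onto.
  rewrite -cV (Phi_color pureX stX cpl) (Psi_color pureX stX coverX cpl).
  split=> //; split; first exact: preim_partitionP.
    by rewrite card_preim_partition q_onto cardsT card_ord.
  by apply: (facets_scattered_color pureX stX cpl); rewrite cV.
have [q qF q_onto] := partition_coloring partF cardF.
have [c [y cpl]] := exists_vertex_coloring pureX stX q cA.
have c_onto := vertex_color_onto pureX stX cpl q_onto.
rewrite -qF (Psi_color pureX stX coverX cpl) (Phi_color pureX stX cpl).
split=> //; split; first exact: preim_partitionP.
  by rewrite card_preim_partition c_onto cardsT card_ord.
by apply: (vertices_scattered_color pureX cpl); rewrite qF.
Qed.
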